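(* Let $\Delta\subset(\mathfrak{t}^n)^*\cong\mathbb{R}^n$ be the Delzant polytope of a toric manifold $X$, and let $V = \mathbb{R}p_{1} + \cdots + \mathbb{R}p_{n-1} + a$ be an $(n-1)$-dimensional affine subspace in $\mathfrak{t}^{n}\cong\mathbb{R}^n$ with rational slope. If for every vertex $\lambda$ of $\Delta$ the rank of the Jacobian matrix $Df^{\lambda}$ is equal to one at every point of the zero locus of $f^{\lambda}$ in $\mathbb{C}^n$, then $V$ is admissible with respect to $\Delta$.
   Context: Identify $\mathfrak{t}^n\cong\mathbb{R}^n$ and $(\mathfrak{t}^n)^*\cong\mathbb{R}^n$, with standard pairing $\langle\cdot,\cdot\rangle$. A convex polytope $\Delta\subset(\mathfrak{t}^n)^*$ is Delzant if each vertex $\lambda$ has exactly $n$ edges, whose direction vectors $v^\lambda_1,\dots,v^\lambda_n$ (pointing from $\lambda$ into the edges) can be chosen in $\mathbb{Z}^n$ and so that they form a $\mathbb{Z}$-basis of $\mathbb{Z}^n$; these are fixed for each vertex. Let $u^\lambda_1,\dots,u^\lambda_n\in\mathbb{Z}^n$ be the dual basis, $\langle u^\lambda_i,v^\lambda_j\rangle=\delta_{ij}$ (the inward normals to the $n$ facets through $\lambda$). The toric manifold $X$ has one chart $U_\lambda\cong\mathbb{C}^n$ with coordinates $z^\lambda=(z^\lambda_1,\dots,z^\lambda_n)$ for each vertex $\lambda$. An $(n-1)$-dimensional affine subspace $V\subset\mathfrak{t}^n$ with linear part $\vec V$ has rational slope if $\vec V\cap\mathbb{Z}^n\cong\mathbb{Z}^{n-1}$.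 Then $V=\mathbb{R}p_1+\cdots+\mathbb{R}p_{n-1}+a$ with $p_1,\dots,p_{n-1}\in\mathbb{Z}^n$ a $\mathbb{Z}$-basis of $\vec V\cap\mathbb{Z}^n$ and $a\in\mathbb{R}^n$. Let $q\in\mathbb{Z}^n$ be a primitive vector spanning the orthogonal complement of $\vec V$ in $\mathbb{R}^n$. The map $i_V^*:(\mathfrak{t}^n)^*\to(\mathfrak{t}^{n-1})^*\cong\mathbb{R}^{n-1}$ is $i_V^*(\xi)=(\langle p_1,\xi\rangle,\dots,\langle p_{n-1},\xi\rangle)$. For a vertex $\lambda$, put $\mathcal{I}^+_\lambda=\{i\mid\langle u^\lambda_i,q\rangle\ge0\}$, $\mathcal{I}^-_\lambda=\{i\mid\langle u^\lambda_i,q\rangle\le0\}$, $\mathcal{I}^0_\lambda=\{i\mid\langle u^\lambda_i,q\rangle=0\}$ (subsets of $\{1,\dots,n\}$), and $$f^\lambda(z^\lambda)=\prod_{j\in\mathcal{I}^+_\lambda\setminus\mathcal{I}^0_\lambda}(z^\lambda_j)^{\langle u^\lambda_j,q\rangle}-e^{\langle a,q\rangle}\prod_{j\in\mathcal{I}^-_\lambda\setminus\mathcal{I}^0_\lambda}(z^\lambda_j)^{-\langle u^\lambda_j,q\rangle},$$ with empty products equal to $1$. A vertex $\lambda$ of $\Delta$ is good with respect to $i_V^*$ if (1) $i_V^*(\lambda)$ is a vertex of the convex polytope $i_V^*(\Delta)$, and (2) $i_V^*(v^\lambda_1),\dots,i_V^*(v^\lambda_n)$ are all nonzero. $V$ is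 admissible with respect to $\Delta$ if for every good vertex $\lambda$ there is $j\in\{1,\dots,n\}$ such that: the $n-1$ vectors $i_V^*(v^\lambda_i)$, $i\ne j$, are linearly independent and $i_V^*\left(\{\sum_{i=1}^n a_iv^\lambda_i\mid a_i\ge0\}\right)=\{\sum_{i\ne j}b_i\,i_V^*(v^\lambda_i)\mid b_i\ge0\}$; and these vectors $i_V^*(v^\lambda_i)$, $i\neq j$, form a $\mathbb{Z}$-basis of $\mathbb{Z}^{n-1}$. *)

(* Defs.v *)
(* Both t^n and its dual are 'rV[R]_n, and a family of k vectors is the matrix of
   its rows. *)
From HB Require Import structures.
From mathcomp Require Import all_boot all_order all_algebra.
From mathcomp Require Import complex.
From mathcomp Require Import all_classical all_reals all_analysis.

Set Implicit Arguments.
Unset Strict Implicit.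
Unset Printing Implicit Defensive.

Import Order.TTheory GRing.Theory Num.Theory.
Import numFieldNormedType.Exports.

Local Open Scope classical_set_scope.
Local Open Scope ring_scope.

Definition pairing (K : nzRingType) (n : nat) (x y : 'rV[K]_n) : K :=
  \sum_i x 0 i * y 0 i.

Definition toR (R : realType) (k n : nat) (M : 'M[int]_(k, n)) : 'M[R]_(k, n) :=
  map_mx intr M.
Arguments toR R {k n} M.

Section Polytopes.
Variables (R : realType) (n : nat).
Implicit Types (P F : set 'rV[R]_n) (x y lam : 'rV[R]_n).

Definition convex_hull (s : seq 'rV[R]_n) : set 'rV[R]_n :=
  [set x | exists c : 'I_(size s) -> R,
     [/\ forall i, 0 <= c i, \sum_i c i = 1 & x = \sum_i c i *: s`_i]].

Definition convex_polytope P : Prop :=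
  exists s : seq 'rV[R]_n, s != [::] /\ P = convex_hull s.

(* Intersections with supporting hyperplanes; w = 0 gives P itself, and set0 is
   also a face. *)
Definition face P F : Prop :=
  exists (w : 'rV[R]_n) (c : R),
    (forall x, P x -> c <= pairing w x) /\
    F = [set x | P x /\ pairing w x = c].

Definition vertex P lam : Prop := face P [set lam].

Definition segment x y : set 'rV[R]_n :=
  [set x + t *: (y - x) | t in [set t : R | 0 <= t <= 1]].

Definition edge P F : Prop :=
  face P F /\ exists x y, x != y /\ F = segment x y.

Definition cone (k : nat) (M : 'M[R]_(k, n)) : set 'rV[R]_n :=
  [set x | exists c : 'I_k -> R,
     (forall i, 0 <= c i) /\ x = \sum_i c i *: row i M].

End Polytopes.

Definition zbasis (k n : nat) (L : set 'rV[int]_n) (b : 'M[int]_(k, n)) : Prop :=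
  (forall x, L x <-> exists c : 'rV[int]_k, x = c *m b) /\
  (forall c : 'rV[int]_k, c *m b = 0 -> c = 0).

Section Delzant.
Variables (R : realType) (n : nat).
Implicit Types (P : set 'rV[R]_n) (lam : 'rV[R]_n) (u v : 'M[int]_n).

(* The rows of v are the v^lam_i: E enumerates all edges through lam, and E i
   starts at lam in direction v_i. *)
Definition edge_basis P lam v : Prop :=
  zbasis [set: 'rV[int]_n] v /\
  exists E : 'I_n -> set 'rV[R]_n,
    [/\ injective E,
        [set F | edge P F /\ F lam] = range E &
        forall i, exists2 t : R, 0 < t &
          E i = segment lam (lam + t *: toR R (row i v))].

Definition delzant P : Prop :=
  convex_polytope P /\
  forall lam, vertex P lam -> exists v, edge_basis P lam v.

Definition dual_basis u v : Prop :=
  forall i j, pairing (row i u) (row j v) = (i == j)%:R.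

End Delzant.

Section AffineSubspaces.
Variables (R : realType) (n : nat).
Implicit Types V : set 'rV[R]_n.

Definition affine_subspace (d : nat) V : Prop :=
  exists (W : 'M[R]_(d, n)) (b : 'rV[R]_n),
    row_free W /\ V = [set c *m W + b | c in [set: 'rV[R]_d]].

Definition direction V : set 'rV[R]_n := [set x - y | x in V & y in V].

Definition direction_lattice V : set 'rV[int]_n :=
  [set x | direction V (toR R x)].

Definition rational_slope V : Prop :=
  exists b : 'M[int]_(n.-1, n), zbasis (direction_lattice V) b.

Definition presents V (p : 'M[int]_(n.-1, n)) (a : 'rV[R]_n) : Prop :=
  zbasis (direction_lattice V) p /\
  V = [set c *m toR R p + a | c in [set: 'rV[R]_n.-1]].

Definition primitive (q : 'rV[int]_n) : Prop :=
  forall (k : int) (r : 'rV[int]_n), q = k *: r -> `|k|%N = 1%N.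

Definition primitive_normal V (q : 'rV[int]_n) : Prop :=
  primitive q /\
  [set w | forall x, direction V x -> pairing x w = 0] =
    [set t *: toR R q | t in [set: R]].

End AffineSubspaces.

(* i_V^*, over R, and over int for its restriction to Z^n. *)
Definition iV (K : nzRingType) (n : nat) (p : 'M[K]_(n.-1, n)) (xi : 'rV[K]_n) :
    'rV[K]_n.-1 :=
  \row_i pairing (row i p) xi.

Section Admissible.
Variables (R : realType) (n : nat).
Implicit Types (P : set 'rV[R]_n) (lam : 'rV[R]_n) (p : 'M[int]_(n.-1, n)).

Definition good P (v : 'rV[R]_n -> 'M[int]_n) p lam : Prop :=
  [/\ vertex P lam,
      vertex (iV (toR R p) @` P) (iV (toR R p) lam) &
      forall i, iV p (row i (v lam)) != 0].

(* The vectors i_V^*(v_i), i != j. *)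
Definition iV_edges p (v : 'M[int]_n) (j : 'I_n) : 'M[int]_(n.-1, n.-1) :=
  row' j (\matrix_i iV p (row i v)).

Definition admissible P (v : 'rV[R]_n -> 'M[int]_n) p : Prop :=
  forall lam, good P v p lam ->
    exists j : 'I_n,
      [/\ row_free (toR R (iV_edges p (v lam) j)),
          iV (toR R p) @` cone (toR R (v lam)) =
            cone (toR R (iV_edges p (v lam) j)) &
          zbasis [set: 'rV[int]_n.-1] (iV_edges p (v lam) j)].

End Admissible.

Section LocalEquation.
Variables (R : realType) (n : nat) (u : 'M[int]_n) (q : 'rV[int]_n).

Definition Iplus : {set 'I_n} := [set i | 0 <= pairing (row i u) q]%SET.
Definition Iminus : {set 'I_n} := [set i | pairing (row i u) q <= 0]%SET.
Definition Izero : {set 'I_n} := [set i | pairing (row i u) q == 0]%SET.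

(* ^ is the integer power; all exponents occurring here are positive. *)
Definition local_eq (a : 'rV[R]_n) (z : 'rV[R[i]]_n) : R[i] :=
  \prod_(j in Iplus :\: Izero) z 0 j ^ pairing (row j u) q
  - (expR (pairing a (toR R q)))%:C%C
    * \prod_(j in Iminus :\: Izero) z 0 j ^ (- pairing (row j u) q).

(* Complex Jacobian matrix; 'J acts on row vectors, so this is the transpose of
   the usual 1 x n matrix of partial derivatives. *)
Definition local_eq_jacobian (a : 'rV[R]_n) (z : 'rV[R[i]]_n) : 'M[R[i]]_(n, 1) :=
  'J (fun y : 'rV[R[i]]_n => (local_eq a y)%:M : 'rV[R[i]]_1) z.

End LocalEquation.

(* Main.v *)
(* Put m_i = <u_i, q>, so that q = \sum_i m_i v_i and \sum_i m_i iV(v_i) = 0. At a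
   good vertex some linear form is positive on every iV(v_i), hence m takes both
   signs and z = 0 lies on the zero locus of f^lam. The Jacobian does not vanish
   there, so one of the two monomials of f^lam is a single coordinate z_j:
   m_j = +-1 and all other m_i have the opposite sign or vanish. Then iV(v_j) is a
   nonnegative combination of the other iV(v_i), which gives the equality of cones;
   moreover q and the v_i, i <> j, form a basis of Z^n, and dividing by q shows that
   the iV(v_i), i <> j, form a basis of Z^(n-1). *)
Require Import Defs.
From HB Require Import structures.
From mathcomp Require Import all_boot all_order all_algebra.
From mathcomp Require Import complex.
From mathcomp Require Import all_classical all_reals all_analysis.
From mathcomp Require Import zify.

Set Implicit Arguments.
Unset Strict Implicit.
Unset Printing Implicit Defensive.

Import Order.TTheory GRing.Theory Num.Theory.
Import numFieldNormedType.Exports.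

Local Open Scope classical_set_scope.
Local Open Scope ring_scope.

(** * Pairings and $i_V^*$ as matrix products *)

Lemma pairing_mulmx (K : comNzRingType) n (x y : 'rV[K]_n) :
  pairing x y = (x *m y^T) 0 0.
Proof. by rewrite mxE; apply: eq_bigr => i _; rewrite !mxE. Qed.

Lemma pairingC (K : comNzRingType) n (x y : 'rV[K]_n) : pairing x y = pairing y x.
Proof. by apply: eq_bigr => i _; rewrite mulrC. Qed.

Lemma pairing_subZl (K : nzRingType) n (x y z : 'rV[K]_n) k :
  pairing (x - k *: y) z = pairing x z - k * pairing y z.
Proof.
rewrite /pairing mulr_sumr -sumrB; apply: eq_bigr => i _.
by rewrite !mxE mulrBl mulrA.
Qed.

Lemma mulmx_tr_pairing (K : comNzRingType) k n (M : 'M[K]_(k, n)) l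
    (N : 'M[K]_(l, n)) i j :
  (M *m N^T) i j = pairing (row i M) (row j N).
Proof. by rewrite mxE; apply: eq_bigr => h _; rewrite !mxE. Qed.

Lemma iV_mulmx (K : comNzRingType) n (p : 'M[K]_(n.-1, n)) xi :
  iV p xi = xi *m p^T.
Proof.
by apply/rowP => i; rewrite mxE (mulmx_tr_pairing xi) row_id pairingC.
Qed.

Lemma iV_edges_mulmx n (p : 'M[int]_(n.-1, n)) v j :
  iV_edges p v j = row' j v *m p^T.
Proof.
apply/matrixP => i h; rewrite !mxE; apply: eq_bigr => l _.
by rewrite !mxE mulrC.
Qed.

Lemma unitmx_zbasis n (B : 'M[int]_n) : B \in unitmx -> zbasis setT B.
Proof.
move=> uB; split=> [x|c cB0]; last by rewrite -(mulmxK uB c) cB0 mul0mx.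
by split=> // _; exists (x *m invmx B); rewrite mulmxKV.
Qed.

Lemma unitmx_row_free_toR (R : realType) n (B : 'M[int]_n) :
  B \in unitmx -> row_free (toR R B).
Proof.
move=> uB; rewrite row_free_unit; apply: (proj1 (@mulmx1_unit _ _ _ (toR R (invmx B)) _)).
by rewrite /toR -map_mxM mulmxV // map_mx1.
Qed.

(** * The lattice of $V$ and its normal [q] *)

Section Normal.
Variables (R : realType) (n : nat) (V : set 'rV[R]_n).
Variables (p : 'M[int]_(n.-1, n)) (a : 'rV[R]_n) (q : 'rV[int]_n).
Hypotheses (V_pa : presents V p a) (q_normal : primitive_normal V q).

Lemma directionP x : direction V x <-> exists c, x = c *m toR R p.
Proof.
case: V_pa => _ ->; split.
  move=> [_ [c _ <-]] [_ [d _ <-]] <-; exists (c - d).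
  by rewrite mulmxBl opprD addrACA subrr addr0.
move=> [c ->]; exists (c *m toR R p + a); first by exists c.
by exists a; [exists 0 => //; rewrite mul0mx add0r | rewrite addrK].
Qed.

(** [toR R q] is orthogonal to the direction of [V], which contains the real rows of [p];
    injectivity of [intr] brings the equation back to the integers. *)
Lemma mulmx_normal : q *m p^T = 0.
Proof.
apply: (can_inj (@trmxK _ _ _)); rewrite trmx_mul trmxK trmx0.
apply/colP => i; rewrite mulmx_tr_pairing mxE row_id.
have [_ qE] := q_normal.
have : [set w | forall x, direction V x -> pairing x w = 0] (toR R q).
  by rewrite qE; exists 1 => //; rewrite scale1r.
move=> /(_ (toR R (row i p))) /(_ _) H; apply: (@intr_inj R).
rewrite -[RHS]H; last first.
  by apply/directionP; exists (delta_mx 0 i); rewrite -rowE /toR map_row.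
by rewrite /pairing rmorph_sum; apply: eq_bigr => h _; rewrite !mxE rmorphM.
Qed.

Lemma normal_neq0 : q != 0.
Proof.
(* The zero vector is [0 *: 0], and the factor 0 does not have absolute value 1, against
   primitivity. *)
apply/eqP => q0; have [/(_ 0 0)] := q_normal.
by rewrite scaler0 => /(_ q0).
Qed.

(* The row space of p is its own double orthogonal, and q spans its orthogonal. *)
Lemma orthogonal_direction (x : 'rV[R]_n) : x *m (toR R q)^T = 0 -> direction V x.
Proof.
move=> xq0; apply/directionP.
suff /submxP[c ->] : (x <= toR R p)%MS by exists c.
rewrite submxE; apply/eqP/rowP => h; rewrite [RHS]mxE.
pose w := row h (cokermx (toR R p))^T.
have [t _ wE] : [set t *: toR R q | t in [set: R]] w.
  have [_ <-] := q_normal => y /directionP[c ->].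
  rewrite pairing_mulmx /w tr_row trmxK -mulmxA colE (mulmxA (toR _ _)) mulmx_coker.
  by rewrite mul0mx mulmx0 mxE.
rewrite -(trmxK (cokermx _)) mulmx_tr_pairing row_id -/w -wE pairing_mulmx.
by rewrite linearZ /= -scalemxAr xq0 scaler0 mxE.
Qed.

(** The rows of [D] are integral and lie in the direction of [V]. As [p] is a $\mathbb{Z}$-basis of
    that lattice, the coefficients can be taken integral, not only real. *)
Lemma orthogonal_lattice k (D : 'M[int]_(k, n)) :
  D *m q^T = 0 -> exists C, D = C *m p.
Proof.
move=> Dq0; have [[pE _] _] := V_pa.
have rowE i : exists c, row i D = c *m p.
  apply/pE/orthogonal_direction; rewrite /toR map_trmx -map_mxM -row_mul Dq0.
  by rewrite row0 map_mx0.
have [c cE] := choice rowE.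
exists (\matrix_i c i); apply/row_matrixP => i.
by rewrite row_mul rowK.
Qed.

(** * Images of the edge vectors at one vertex *)

Variables (u v : 'M[int]_n).
Hypothesis uv : dual_basis u v.

(** Duality says [u *m v^T = 1]; for square matrices the inverse is two-sided, whence
    [u^T *m v = 1]. *)
Lemma normal_expansion : q = \sum_i pairing (row i u) q *: row i v.
Proof.
have uv1 : u *m v^T = 1%:M.
  by apply/matrixP => i j; rewrite mulmx_tr_pairing uv mxE.
have -> : \sum_i pairing (row i u) q *: row i v = q *m u^T *m v.
  rewrite mulmx_sum_row; apply: eq_bigr => i _; congr (_ *: _).
  by rewrite mulmx_tr_pairing row_id pairingC.
by rewrite -mulmxA -[v]trmxK -trmx_mul (mulmx1C uv1) trmx1 mulmx1.
Qed.

Lemma sum_iV_edges : \sum_i pairing (row i u) q *: iV p (row i v) = 0.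
Proof.
rewrite -[RHS]mulmx_normal [in RHS]normal_expansion mulmx_suml; apply: eq_bigr => i _.
by rewrite iV_mulmx scalemxAl.
Qed.

Variable j : 'I_n.
(** This form of $m_j=\pm1$ avoids splitting on the sign: multiplication by $m_j$ is its own
    inverse. *)
Hypothesis qj2 : pairing (row j u) q * pairing (row j u) q = 1.

(* The rows u_i - <u_i, q> <u_j, q> u_j, i <> j, are the vectors other than the
   j-th of the basis dual to v with q put in place of v_j. *)
Lemma iV_edges_unitmx : iV_edges p v j \in unitmx.
Proof.
pose m i := pairing (row i u) q.
pose D := \matrix_(i < n.-1) (row (lift j i) u - (m (lift j i) * m j) *: row j u).
have /orthogonal_lattice[C DC] : D *m q^T = 0.
  apply/colP => i; rewrite mulmx_tr_pairing row_id rowK pairing_subZl.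
  by rewrite -mulrA qj2 mulr1 subrr mxE.
(* Since [D = C *m p], this product is the matrix of pairings of the rows of [D] with the $v_l$,
   $l\ne j$; the correction along $u_j$ does not see these. *)
have : C *m (iV_edges p v j)^T = 1%:M.
  rewrite iV_edges_mulmx trmx_mul trmxK mulmxA -DC.
  apply/matrixP => i l; rewrite mulmx_tr_pairing rowK pairing_subZl.
  have -> : row l (row' j v) = row (lift j l) v by apply/rowP => h; rewrite !mxE.
  by rewrite !uv (negPf (neq_lift j l)) mulr0 subr0 (inj_eq lift_inj) mxE.
by move=> /mulmx1_unit[_]; rewrite unitmx_tr.
Qed.

Hypothesis qj_opp : forall i, i != j -> pairing (row i u) q * pairing (row j u) q <= 0.

(** Multiplying the relation $\sum_i m_i\,i_V^*(v_i)=0$ by $m_j$ solves it for $i_V^*(v_j)$ with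
    coefficients $-m_im_j\ge0$, so the $j$-th generator of the image cone is redundant. *)
Lemma iV_cone :
  iV (toR R p) @` cone (toR R v) = cone (toR R (iV_edges p v j)).
Proof.
pose m i := pairing (row i u) q.
pose w i := toR R (iV p (row i v)).
have iVw i : iV (toR R p) (row i (toR R v)) = w i.
  by rewrite /w !iV_mulmx /toR -map_row map_trmx map_mxM.
have edgeE i : row i (toR R (iV_edges p v j)) = w (lift j i).
  rewrite /w /toR -map_row; congr map_mx; rewrite iV_edges_mulmx iV_mulmx row_mul.
  by congr (_ *m _); apply/rowP => h; rewrite !mxE.
have iVsum (c : 'I_n -> R) :
    iV (toR R p) (\sum_i c i *: row i (toR R v)) = \sum_i c i *: w i.
  rewrite iV_mulmx mulmx_suml; apply: eq_bigr => i _.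
  by rewrite -scalemxAl -iV_mulmx iVw.
have wj : w j = \sum_i (- (m (lift j i) * m j))%:~R *: w (lift j i).
  have := congr1 (toR R) sum_iV_edges.
  rewrite /toR raddf_sum map_mx0 (bigD1_ord j) //=.
  move=> /(congr1 ( *:%R (m j)%:~R)); rewrite scaler0 scalerDr.
  rewrite map_mxZ scalerA -rmorphM qj2 scale1r => /eqP.
  rewrite addr_eq0 => /eqP wjE; rewrite /w /toR wjE.
  rewrite scaler_sumr -sumrN; apply: eq_bigr => i _.
  by rewrite map_mxZ scalerA -rmorphM -scaleNr rmorphN /= mulrC.
apply/seteqP; split=> [_ [_ [c [c0 ->]] <-]|_ [b [b0 ->]]].
  exists (fun i => c (lift j i) + c j * (- (m (lift j i) * m j))%:~R); split=> [i|].
    rewrite addr_ge0 // mulr_ge0 // ler0z oppr_ge0 qj_opp //.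
    by rewrite eq_sym neq_lift.
  rewrite iVsum (bigD1_ord j) //= {1}wj scaler_sumr -big_split.
  by apply: eq_bigr => i _ /=; rewrite edgeE scalerA -scalerDl addrC.
(* The default 0 of [oapp] is the coefficient of the omitted vector $v_j$. *)
exists (\sum_i oapp b 0 (unlift j i) *: row i (toR R v)).
  exists (fun i => oapp b 0 (unlift j i)); split=> // i.
  by case: unliftP => [h _|_] /=.
rewrite iVsum (bigD1_ord j) //= unlift_none scale0r add0r.
by apply: eq_bigr => i _; rewrite liftK edgeE.
Qed.

End Normal.

(** * Vanishing of the derivative at the origin *)

Lemma coord_le_norm (K : numFieldType) n (z : 'rV[K]_n) j : `|z 0 j| <= `|z|.
Proof.
rewrite /Num.norm /= mx_normE.
exact: (le_bigmax _ (fun ij : 'I_1 * 'I_n => `|z ij.1 ij.2|%:nng) (0, j)).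
Qed.

Lemma scalar_mx1_norm (K : numFieldType) (x : K) : `|x%:M : 'rV[K]_1| <= `|x|.
Proof.
rewrite {1}/Num.norm /= mx_normE (_ : `|x| = (`|x|%:nng)%:num) // num_le.
apply/bigmax_leP; split=> [|[i j] _]; first by rewrite -num_le /=.
by rewrite -num_le /= !ord1 mxE eqxx.
Qed.

(** In the maximum norm each coordinate is at most $|z|$, so the monomial is at most $|z|$ to its
    total degree; for $|z|\le1$ the exponent may be lowered to 2. *)
Lemma monomial_le (K : numFieldType) n (S : {set 'I_n}) (e : 'I_n -> int)
    (z : 'rV[K]_n) :
  (forall j, j \in S -> 0 < e j) -> (2 <= \sum_(j in S) `|e j|)%N ->
  `|z| <= 1 -> `|\prod_(j in S) z 0 j ^ e j| <= `|z| ^+ 2.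
Proof.
move=> e_gt0 e_ge2 z1; rewrite normr_prod.
apply: (@le_trans _ _ (\prod_(j in S) `|z| ^+ `|e j|)).
  apply: ler_prod => j jS; rewrite normr_ge0 /=.
  rewrite -[X in _ ^ X]gtz0_abs ?e_gt0 // -exprnP normrX.
  by apply: lerXn2r; rewrite ?nnegrE ?normr_ge0 ?coord_le_norm.
by rewrite prodrXr; apply: ler_wiXn2l.
Qed.

(** A quadratic bound is $o(|z|)$, so the zero map satisfies the property that characterizes the
    differential. *)
Lemma diff0_quadratic (K : numFieldType) n (f : 'rV[K]_n -> 'rV[K]_1) (k : K) :
  f 0 = 0 -> 0 < k -> (forall z, `|z| <= 1 -> `|f z| <= k * `|z| ^+ 2) ->
  'J f 0 = 0.
Proof.
move=> f0 k_gt0 f_le.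
have df0 : 'd f (0 : 'rV[K]_n) = \0 :> ('rV[K]_n -> 'rV[K]_1).
  apply: (@diff_unique K _ _ f \0); first exact: cst_continuous.
  apply/eqaddoP => e e_gt0; apply/(@nbhs_norm0P K 'rV[K]_n).
  have ke_gt0 : 0 < k + e by exact: addr_gt0.
  (* This radius gives $|z|k+|z|e<e$, hence both $|z|\le1$, where the bound applies, and $k|z|\le
     e$. *)
  exists (e / (k + e)) => /=; first by rewrite divr_gt0.
  move=> z /=; rewrite ltr_pdivlMr // mulrDr => zke.
  have z1 : `|z| <= 1.
    rewrite -(ler_pM2r e_gt0) mul1r (le_trans _ (ltW zke)) // lerDr.
    by rewrite mulr_ge0 // ltW.
  have -> : (f \o shift 0 - (cst (f 0) + \0)) z = f z.
    by rewrite !fctE /= f0 !addr0 subr0.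
  apply: le_trans (f_le _ z1) _.
  rewrite expr2 mulrA ler_wpM2r // mulrC (le_trans _ (ltW zke)) // lerDl.
  by rewrite mulr_ge0 // ltW.
by apply/row_matrixP => i; rewrite rowE mul_rV_lin1 df0 row0.
Qed.

Lemma sum_le1 (I : finType) (S : {set I}) (e : I -> nat) i0 :
  (forall i, i \in S -> (0 < e i)%N) -> i0 \in S -> (\sum_(i in S) e i <= 1)%N ->
  e i0 = 1%N /\ forall i, i \in S -> i = i0.
Proof.
move=> e_gt0 i0S; rewrite (bigD1 i0) //= => le1.
have e0 := e_gt0 _ i0S; split; first by lia.
move=> i iS; apply/eqP; apply: contraT => ne; move: le1.
by rewrite (bigD1 i) /= ?iS //; have := e_gt0 _ iS; lia.
Qed.

(** * Exponents of the local equation *)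

Section Singular.
Variables (R : realType) (n : nat) (u : 'M[int]_n) (q : 'rV[int]_n).
Variable a : 'rV[R]_n.
Let m i := pairing (row i u) q.

Lemma mem_pos i : (i \in Iplus u q :\: Izero u q) = (0 < m i).
Proof. by rewrite !inE lt_def. Qed.

Lemma mem_neg i : (i \in Iminus u q :\: Izero u q) = (m i < 0).
Proof. by rewrite !inE lt_def eq_sym. Qed.

Lemma monomial0 (S : {set 'I_n}) (e : 'I_n -> int) i :
  i \in S -> e i != 0 -> \prod_(j in S) (0 : 'rV[R[i]]_n) 0 j ^ e j = 0.
Proof.
by move=> iS ei0; rewrite (bigD1 i) //= mxE exp0rz (negPf ei0) mul0r.
Qed.

(** Both monomials are nonconstant, so the origin is a zero. If both had degree at least 2, the
    equation would vanish there to second order; hence one has degree 1 and consists of a single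
    coordinate. *)
Lemma unit_exponent i k : 0 < m i -> m k < 0 ->
  (local_eq u q a 0 = 0 -> \rank (local_eq_jacobian u q a 0) = 1%N) ->
  exists j, m j * m j = 1 /\ forall i, i != j -> m i * m j <= 0.
Proof.
move=> mi mk rank1.
have f0 : local_eq u q a 0 = 0.
  rewrite /local_eq (monomial0 (i := i)) ?mem_pos ?gt_eqF //.
  by rewrite (monomial0 (i := k)) ?mem_neg ?oppr_eq0 ?lt_eqF // mulr0 subr0.
have {rank1} := rank1 f0.
have pos_gt0 j : j \in Iplus u q :\: Izero u q -> (0 < `|m j|)%N.
  by rewrite mem_pos absz_gt0 => /gt_eqF ->.
have neg_gt0 j : j \in Iminus u q :\: Izero u q -> (0 < `|- m j|)%N.
  by rewrite mem_neg abszN absz_gt0 => /lt_eqF ->.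
(* If the first monomial has degree at most 1, it is $z_i$, and [j] is [i] with exponent 1. *)
have [pos2|] := leqP 2 (\sum_(j in Iplus u q :\: Izero u q) `|m j|); last first.
  rewrite ltnS => /sum_le1 H _.
  have /(H i pos_gt0)[mi1 mE] : i \in Iplus u q :\: Izero u q by rewrite mem_pos.
  have {mi1} mi1 : m i = 1 by rewrite -[LHS]gtz0_abs // mi1.
  exists i; rewrite mi1; split=> // j ji; rewrite mulr1 leNgt -mem_pos.
  by apply: contra ji => /mE ->.
(* If the second monomial has degree at most 1, it is $z_k$, and [j] is [k] with $m_k=-1$. *)
have [neg2|] := leqP 2 (\sum_(j in Iminus u q :\: Izero u q) `|- m j|); last first.
  rewrite ltnS => /sum_le1 H _.
  have /(H k neg_gt0)[mk1 mE] : k \in Iminus u q :\: Izero u q by rewrite mem_neg.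
  have {mk1} mk1 : m k = -1 by apply: oppr_inj; rewrite opprK -[LHS]gtz0_abs ?oppr_gt0 // mk1.
  exists k; rewrite mk1; split=> // j jk; rewrite mulrN1 oppr_le0 leNgt -mem_neg.
  by apply: contra jk => /mE ->.
(* With both degrees at least 2 the Jacobian is zero, of rank 0, against the rank hypothesis. *)
suff -> : local_eq_jacobian u q a 0 = 0 by rewrite mxrank0.
pose c := (expR (pairing a (toR R q)))%:C%C : R[i].
(* The two summands bound the first monomial and [c] times the second one. *)
apply: (@diff0_quadratic _ _ _ (1 + `|c|)) => [||z z1].
- by rewrite f0 raddf0.
- by rewrite ltr_wpDr.
apply: le_trans (scalar_mx1_norm _) _; apply: le_trans (ler_normB _ _) _; rewrite mulrDl mul1r lerD //.
  by apply: monomial_le => // j; rewrite mem_pos.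
rewrite normrM ler_wpM2l //.
by apply: monomial_le => // j; rewrite mem_neg oppr_gt0.
Qed.

End Singular.

(** * Positivity at a good vertex and the signs of the exponents *)

(** If no $m_i$ were positive, the terms $-m_ig_i$ would be nonnegative with sum zero, so each would
    vanish, including the one at [k]. *)
Lemma sum_mul_eq0_pos (R : numDomainType) n (m g : 'I_n -> R) k :
  (forall i, m i \is Num.real) -> (forall i, 0 < g i) -> m k != 0 ->
  \sum_i m i * g i = 0 -> exists i, 0 < m i.
Proof.
move=> m_real g_gt0 mk sum0; apply: contrapT => /forallNP m_le0.
have {}m_le0 i : 0 <= - m i * g i.
  rewrite mulr_ge0 ?(ltW (g_gt0 i)) // oppr_ge0 real_leNgt ?real0 //.
  exact/negP/m_le0.
move: sum0 => /eqP; rewrite -oppr_eq0 -sumrN.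
under eq_bigr do rewrite -mulNr.
rewrite psumr_eq0 // => /allP/(_ k); rewrite mem_index_enum => /(_ isT) /=.
by rewrite mulf_eq0 oppr_eq0 (negPf mk) gt_eqF.
Qed.

(** An edge is a face, hence contained in [P]; the point is its far end. *)
Lemma edge_basis_mem (R : realType) n (P : set 'rV[R]_n) lam v i :
  edge_basis P lam v -> exists2 t : R, 0 < t & P (lam + t *: toR R (row i v)).
Proof.
move=> [_ [E [_ edgesE EE]]]; have [t t_gt0 Ei] := EE i; exists t => //.
have [[[w [c [_ Fdef]]] _] _] : [set F | edge P F /\ F lam] (E i).
  by rewrite edgesE; exists i.
have : E i (lam + t *: toR R (row i v)).
  by rewrite Ei; exists 1; rewrite /= ?ler01 ?lexx // scale1r addrC subrK.
by rewrite Fdef => -[].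
Qed.

(** [w] is the form supporting $i_V^*(P)$ at its vertex $i_V^*(\lambda)$. It cannot decrease along
    the image of an edge, and if it were constant there, the moved point would lie in the face
    $\{i_V^*(\lambda)\}$, forcing $i_V^*(v_i)=0$. *)
Lemma good_pairing (R : realType) n (P : set 'rV[R]_n) v p lam :
  edge_basis P lam (v lam) -> good P v p lam ->
  exists w, forall i, 0 < pairing w (toR R (iV p (row i (v lam)))).
Proof.
move=> basis [_ [w [c [w_ge wE]]] nz]; exists w => i.
have [t t_gt0 Pt] := edge_basis_mem i basis.
pose e := toR R (iV p (row i (v lam))).
have iVt : iV (toR R p) (lam + t *: toR R (row i (v lam))) =
    iV (toR R p) lam + t *: e.
  by rewrite /e !iV_mulmx mulmxDl -scalemxAl /toR map_trmx map_mxM.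
have [_ wlam] : (iV (toR R p) @` P) (iV (toR R p) lam) /\
    pairing w (iV (toR R p) lam) = c.
  by have : [set iV (toR R p) lam] (iV (toR R p) lam) by []; rewrite wE.
have wt : pairing w (iV (toR R p) lam + t *: e) = c + t * pairing w e.
  by rewrite -wlam !pairing_mulmx linearD linearZ /= mulmxDr -scalemxAr !mxE.
have Pe : (iV (toR R p) @` P) (iV (toR R p) lam + t *: e).
  by rewrite -iVt; exists (lam + t *: toR R (row i (v lam))).
rewrite lt_def; apply/andP; split; last first.
  by have := w_ge _ Pe; rewrite wt lerDl pmulr_rge0.
apply: contra (nz i) => /eqP we0.
have : [set iV (toR R p) lam] (iV (toR R p) lam + t *: e).
  by rewrite wE; split=> //; rewrite wt we0 mulr0 addr0.
move=> /= /eqP; rewrite -subr_eq0 addrC addKr scaler_eq0 gt_eqF //= => /eqP e0.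
apply/eqP/rowP => h; move/rowP: e0 => /(_ h)/eqP.
by rewrite [_ 0 h]mxE [in X in _ == X]mxE intr_eq0 => /eqP ->; rewrite mxE.
Qed.

Theorem theorem1p5 (R : realType) (n : nat) (n_gt0 : (0 < n)%N)
  (Delta : set 'rV[R]_n) (Delta_delzant : delzant Delta)
  (v : 'rV[R]_n -> 'M[int]_n)
  (v_edges : forall lam, vertex Delta lam -> edge_basis Delta lam (v lam))
  (u : 'rV[R]_n -> 'M[int]_n)
  (u_dual : forall lam, vertex Delta lam -> dual_basis (u lam) (v lam))
  (V : set 'rV[R]_n)
  (V_affine : affine_subspace n.-1 V) (V_rational : rational_slope V)
  (p : 'M[int]_(n.-1, n)) (a : 'rV[R]_n) (V_pa : presents V p a)
  (q : 'rV[int]_n) (q_normal : primitive_normal V q)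
  (rank_one : forall lam, vertex Delta lam ->
     forall z : 'rV[R[i]]_n, local_eq (u lam) q a z = 0 ->
       \rank (local_eq_jacobian (u lam) q a z) = 1%N) :
  admissible Delta v p.
Proof.
move=> lam lam_good; have [lam_vertex _ _] := lam_good.
have [w w_gt0] := good_pairing (v_edges _ lam_vertex) lam_good.
have uv := u_dual _ lam_vertex.
pose m i := pairing (row i (u lam)) q.
(* Otherwise the expansion of [q] in the $v_i$ would make [q] zero. *)
have [k mk] : exists k, m k != 0.
  apply: contrapT => /forallNP m0; have /negP := normal_neq0 q_normal; apply.
  rewrite (normal_expansion q uv); apply/eqP/big1 => i _.
  by have /negP := m0 i; rewrite negbK -/(m i) => /eqP ->; rewrite scale0r.
pose g i := pairing w (toR R (iV p (row i (v lam)))).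
(* Pairing the relation between the $i_V^*(v_i)$ with [w] leaves a vanishing sum with positive
   weights [g]. *)
have mg0 : \sum_i (m i)%:~R * g i = 0 :> R.
  transitivity (pairing w (toR R (\sum_i m i *: iV p (row i (v lam))))); last first.
    rewrite (sum_iV_edges V_pa q_normal uv) /toR map_mx0 pairing_mulmx.
    by rewrite trmx0 mulmx0 mxE.
  rewrite [RHS]pairing_mulmx /toR [map_mx _ (\sum_i _)]raddf_sum raddf_sum.
  rewrite mulmx_sumr summxE; apply: eq_bigr => i _.
  by rewrite /g pairing_mulmx /= map_mxZ linearZ /= -scalemxAr [RHS]mxE.
have mkR : (m k)%:~R != 0 :> R by rewrite intr_eq0.
have [i mi] : exists i, 0 < m i.
  have [|i] := sum_mul_eq0_pos _ w_gt0 mkR mg0; first by move=> i; exact: num_real.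
  by rewrite ltr0z; exists i.
have [l ml] : exists l, m l < 0.
  (* The same argument applied to $-m$ yields a negative exponent. *)
  have [|||l] := @sum_mul_eq0_pos _ _ (fun i => - (m i)%:~R) g k _ w_gt0.
  - by move=> l; exact: num_real.
  - by rewrite oppr_eq0.
  - by under eq_bigr do rewrite mulNr; rewrite sumrN mg0 oppr0.
  - by rewrite oppr_gt0 ltrz0; exists l.
have [j [mj2 mj_opp]] := unit_exponent mi ml (@rank_one _ lam_vertex 0).
exists j; have unitE := iV_edges_unitmx V_pa q_normal uv mj2.
split; [exact: unitmx_row_free_toR | exact: (iV_cone V_pa q_normal uv mj2 mj_opp)
  | exact: unitmx_zbasis].
Qed.
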